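(* Let $\xi_1,\xi_2,\xi_3\in\mathrm{SL}(2,\mathbb{C})$ and set $t_i=\mathrm{tr}(\xi_i)$, $t_{ij}=\mathrm{tr}(\xi_i\xi_j)$, $t_{ijk}=\mathrm{tr}(\xi_i\xi_j\xi_k)$. Then $$t_{123}+t_{132}=t_{12}t_3+t_{13}t_2+t_{23}t_1-t_1t_2t_3$$ and $$t_{123}\,t_{132}=(t_1^2+t_2^2+t_3^2)+(t_{12}^2+t_{23}^2+t_{13}^2)-(t_1t_2t_{12}+t_2t_3t_{23}+t_3t_1t_{13})+t_{12}t_{23}t_{13}-4.$$
   Context: $\mathrm{tr}$ denotes the trace of a $2\times2$ complex matrix. *)

(* Defs.v *)
From mathcomp Require Export all_boot all_order all_algebra.
From mathcomp Require Export reals complex.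

(* Main.v *)
Require Import Defs.
From mathcomp Require Import all_boot all_order all_algebra.
From mathcomp Require Import reals complex.
From mathcomp Require Import ring.
Import GRing.Theory Num.Theory.
Local Open Scope ring_scope.

(** Both formulas are specialisations, at determinant one, of identities that
    hold for arbitrary two-by-two matrices over a commutative ring.

    The sum formula is the polarised Cayley-Hamilton theorem: linearising
    [A ^ 2 - tr A * A + det A = 0] gives
    [A B + B A = tr A * B + tr B * A + (tr (A B) - tr A * tr B)], and the trace
    of this equation multiplied by [C] is the claim, as
    [tr (B A C) = tr (A C B)].

    For the product formula, let [s] be the sum just computed and let [a], [b],
    [c] be the trace-free parts of [A], [B], [C], with 2 inverted. Since
    [tr (a c b) = - tr (a b c)], the two triple traces are [s / 2 + tr (a b c)]
    and [s / 2 - tr (a b c)], so their product is [s ^ 2 / 4 - tr (a b c) ^ 2].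
    The form [tr (a b c)] is alternating on the three-dimensional space of
    trace-free matrices, so its square is a constant multiple (the constant is
    - 1 / 2) of the Gram determinant of [a], [b], [c] for the form [tr (x y)].
    The entries of that determinant are [tr (a b) = tr (A B) - tr A * tr B / 2]
    and its analogues, and [tr (a a) = tr A ^ 2 / 2 - 2 det A]. Hence the product
    depends only on the traces of the matrices, the traces of their pairwise
    products, and the determinants. The resulting formula has integer
    coefficients, so it is an identity of polynomials in the twelve entries, and
    expanding it is a complete proof. *)

Lemma sum_ord2 (V : nmodType) (F : 'I_2 -> V) : \sum_i F i = F 0 + F 1.
Proof.
by rewrite big_ord_recl big_ord1; congr (_ + F _); apply/val_inj.
Qed.

Lemma trace_mx2 (K : comNzRingType) (A : 'M[K]_2) : \tr A = A 0 0 + A 1 1.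
Proof. exact: sum_ord2. Qed.

Lemma mulmx2E (K : comNzRingType) (A B : 'M[K]_2) i j :
  (A *m B) i j = A i 0 * B 0 j + A i 1 * B 1 j.
Proof. by rewrite mxE sum_ord2. Qed.

Lemma det_mx2 (K : comNzRingType) (A : 'M[K]_2) :
  \det A = A 0 0 * A 1 1 - A 0 1 * A 1 0.
Proof.
rewrite (expand_det_row _ 0) sum_ord2 /cofactor !det_mx11 !mxE /=.
rewrite expr0 expr1 mul1r mulN1r mulrN.
by congr (_ * A _ _ - _ * A _ _); apply/val_inj.
Qed.

(** The trace of the polarised Cayley-Hamilton identity against [C]. *)
Lemma trace_triple_sum (K : comNzRingType) (A B C : 'M[K]_2) :
  \tr (A *m B *m C) + \tr (A *m C *m B) =
    \tr (A *m B) * \tr C + \tr (A *m C) * \tr B + \tr (B *m C) * \tr A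
    - \tr A * \tr B * \tr C.
Proof. by rewrite !trace_mx2 !mulmx2E; ring. Qed.

(** The homogeneous form of the product formula: the determinants make every
    term quadratic in each of [A], [B] and [C], as the left-hand side is, and
    this turns the formula into a polynomial identity in the entries. *)
Lemma trace_triple_prod (K : comNzRingType) (A B C : 'M[K]_2) :
  \tr (A *m B *m C) * \tr (A *m C *m B) =
    (\det B * \det C * \tr A ^+ 2 + \det A * \det C * \tr B ^+ 2
     + \det A * \det B * \tr C ^+ 2)
    + (\det C * \tr (A *m B) ^+ 2 + \det A * \tr (B *m C) ^+ 2
       + \det B * \tr (A *m C) ^+ 2)
    - (\det C * (\tr A * \tr B * \tr (A *m B))
       + \det A * (\tr B * \tr C * \tr (B *m C))
       + \det B * (\tr C * \tr A * \tr (A *m C)))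
    + \tr (A *m B) * \tr (B *m C) * \tr (A *m C)
    - 4 * (\det A * \det B * \det C).
Proof. by rewrite !det_mx2 !trace_mx2 !mulmx2E; ring. Qed.

(* MathComp; the complex numbers are R[i] for R a realType. *)
Theorem mainTheorem6 (R : realType) (xi1 xi2 xi3 : 'M[R[i]]_2)
  (hxi1 : \det xi1 = 1) (hxi2 : \det xi2 = 1) (hxi3 : \det xi3 = 1) :
  let t1 := \tr xi1 in
  let t2 := \tr xi2 in
  let t3 := \tr xi3 in
  let t12 := \tr (xi1 *m xi2) in
  let t13 := \tr (xi1 *m xi3) in
  let t23 := \tr (xi2 *m xi3) in
  let t123 := \tr (xi1 *m xi2 *m xi3) in
  let t132 := \tr (xi1 *m xi3 *m xi2) in
  t123 + t132 = t12 * t3 + t13 * t2 + t23 * t1 - t1 * t2 * t3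
  /\
  t123 * t132 =
    (t1 ^+ 2 + t2 ^+ 2 + t3 ^+ 2) + (t12 ^+ 2 + t23 ^+ 2 + t13 ^+ 2)
    - (t1 * t2 * t12 + t2 * t3 * t23 + t3 * t1 * t13)
    + t12 * t23 * t13 - 4.
Proof.
split; first exact: trace_triple_sum.
by rewrite /= trace_triple_prod hxi1 hxi2 hxi3 !mul1r mulr1.
Qed.
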